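(* Let $A_0\in\mathbb{R}^{n\times n}$ and let $a,b,c\in\mathbb{R}^n$ be column vectors. Let $A_1=A_0+ba^T$ and $A_2=A_0+bc^T$, and assume that $A_1$ and $A_2$ are Schur stable and $\mathrm{rank}(A_1-A_2)=1$. With $\cdot$ denoting the bialternate product, $d=n(n-1)/2$, and $I_d$ the $d\times d$ identity matrix, put $$F_0=I_d-A_2\cdot A_2,\qquad F_1=-2(A_1\cdot A_2-A_2\cdot A_2).$$ Then every matrix of the segment $[A_1,A_2]=\{\alpha A_1+(1-\alpha)A_2:\alpha\in[0,1]\}$ is Schur stable if and only if both of the following hold: (i) the matrices $(I-A_1)(I-A_2)^{-1}$ and $(I+A_1)(I+A_2)^{-1}$ have no real negative eigenvalue; (ii) $-F_0^{-1}F_1$ has no real eigenvalue in $[1,\infty)$.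
   Context: A real $n\times n$ matrix is Schur stable if all its (complex) eigenvalues lie in the open unit disk. $I$ is the $n\times n$ identity matrix. Bialternate product: for $A=[a_{ij}],B=[b_{ij}]\in\mathbb{R}^{n\times n}$, $A\cdot B$ is the $d\times d$ matrix, $d=n(n-1)/2$, with rows and columns indexed (in a fixed order) by the pairs $(p,q)$ with $1\le p<q\le n$, whose entry in row $(i,j)$ and column $(k,l)$ is $$f_{ij,kl}=\frac12\left(\begin{vmatrix} a_{ik} & a_{il} \\ b_{jk} & b_{jl} \end{vmatrix}+\begin{vmatrix} b_{ik} & b_{il} \\ a_{jk} & a_{jl} \end{vmatrix}\right).$$ When $A_2$ is Schur stable, $F_0$ is invertible, since the eigenvalues of $A_2\cdot A_2$ are the products $\lambda_i\lambda_j$ ($i<j$) of the eigenvalues $\lambda_1,\dots,\lambda_n$ of $A_2$. *)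

(* Defs.v *)
From mathcomp Require Import all_boot all_order all_algebra.
From mathcomp Require Import complex.
From mathcomp Require Import reals.

Set Implicit Arguments.
Unset Strict Implicit.
Unset Printing Implicit Defensive.

Import Order.TTheory GRing.Theory Num.Theory.
Local Open Scope ring_scope.

Definition ord_pairs (n : nat) : {set 'I_n * 'I_n} :=
  [set p : 'I_n * 'I_n | (p.1 < p.2)%N].

Lemma card_ord_pairs (n : nat) : #|ord_pairs n| = ((n * n.-1)./2)%N.
Proof.
rewrite -bin2 -bin2_sum big_mkord -sum1_card.
rewrite (eq_bigl (fun p : 'I_n * 'I_n => true && (p.1 < p.2)%N)); last first.
  by move=> p; rewrite inE.
rewrite -(pair_big_dep xpredT (fun i j : 'I_n => (i < j)%N) (fun _ _ => 1%N)).
rewrite (exchange_big_dep xpredT) //=; apply: eq_bigr => j _.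
rewrite (big_ord_narrow (F := fun=> 1%N) (ltnW (ltn_ord j))).
by rewrite sum1_card card_ord.
Qed.

Definition det2 (F : fieldType) (x y z t : F) : F := x * t - y * z.

(* Rows and columns are indexed by the pairs (p, q) with p < q, in the order
   in which enum lists them. *)
Definition bialternate (F : fieldType) (n : nat) (A B : 'M[F]_n) :
    'M[F]_#|ord_pairs n| :=
  \matrix_(r, s)
    let: (i, j) := enum_val r in
    let: (k, l) := enum_val s in
    2%:R^-1 * (det2 (A i k) (A i l) (B j k) (B j l)
               + det2 (B i k) (B i l) (A j k) (A j l)).

Definition schur_stable (R : realType) (n : nat) (A : 'M[R]_n) : Prop :=
  forall z : R[i], eigenvalue (map_mx (real_complex R) A) z -> `|z| < 1.

(* Main.v *)
(** Since A1 - A2 has rank one, the characteristic polynomial of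
    A(t) = t A1 + (1 - t) A2 is affine in t, and A(t) . A(t) is affine in t as
    well, so that I - A(t) . A(t) = F0 + t F1.  Hence (i) says that neither 1 nor
    -1 is an eigenvalue of A(t) for 0 < t < 1, and (ii) that F0 + t F1 is
    invertible for 0 < t <= 1.

    The bialternate square of A is the action V |-> A^T V A on antisymmetric
    matrices V.  If A is Schur stable, the Stein equation A^T V A = V has only the
    zero solution, so I - A . A is invertible.  If x + i y is a (row) eigenvector
    for an eigenvalue on the unit circle other than 1 and -1, then
    V = x^T y - y^T x is a nonzero solution, so I - A . A is singular.

    Finally, if A(t) has no eigenvalue on the unit circle for t in [0, 1], the set
    of t such that A(t) is stable is open and closed in [0, 1]; both facts follow
    from lower bounds on |p(z)| for the monic polynomial p with roots in the open
    disc, using its factorization. *)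

Require Import Defs.
From mathcomp Require Import all_boot all_order all_algebra.
From mathcomp Require Import complex.
From mathcomp Require Import reals.
From mathcomp Require Import ring lra.

Set Implicit Arguments.
Unset Strict Implicit.
Unset Printing Implicit Defensive.

Import Order.TTheory GRing.Theory Num.Theory.
Local Open Scope ring_scope.

(** * Determinants and characteristic polynomials under rank-one updates *)

(** Block elimination of the corner 1. The bordered matrix confines [v] to its first row, so the
    determinant becomes affine in [v]. *)
Lemma det_add_rank1 (S : comNzRingType) (n : nat) (M : 'M[S]_n) (u v : 'cV[S]_n) :
  \det (M + u *m v^T) = \det (block_mx (1%:M : 'M_1) (- v^T) u M).
Proof.
have -> : block_mx (1%:M : 'M_1) (- v^T) u M =
    block_mx 1%:M 0 u 1%:M *m block_mx 1%:M (- v^T) 0 (M + u *m v^T).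
  rewrite mulmx_block !mul1mx !mul0mx mulmx1 !addr0 mulmxN.
  by rewrite addrCA addNr addr0.
by rewrite det_mulmx det_lblock det_ublock !det1 !mul1r.
Qed.

(** Multilinearity in the first row of the bordered matrix: (1, -t v^T) = t (1, -v^T) + (1 - t) (1,
    0). A commutative ring is allowed so that the entries can be polynomials. *)
Lemma det_add_scale_rank1 (S : comNzRingType) (n : nat) (M : 'M[S]_n)
    (u v : 'cV[S]_n) (t : S) :
  \det (M + t *: (u *m v^T)) = t * \det (M + u *m v^T) + (1 - t) * \det M.
Proof.
have {3}-> : M = M + u *m (0 : 'cV_n)^T by rewrite trmx0 mulmx0 addr0.
rewrite scalemxAr -linearZ /= !det_add_rank1.
apply: (@determinant_multilinear _ _ _ _ _ (lshift n (ord0 : 'I_1))).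
- apply/rowP => j; rewrite [LHS]mxE [RHS]mxE [X in _ = X + _]mxE [X in _ = _ + X]mxE.
  rewrite [row _ _ _ _]mxE [in X in _ = _ + X]mxE !col_mxEu.
  by case: (split_ordP j) => k ->; rewrite ?row_mxEl ?row_mxEr !mxE; ring.
- apply/matrixP => i j; rewrite ![row' _ _ _ _]mxE.
  case: (split_ordP (lift (lshift n (ord0 : 'I_1)) i)) => k; last by move=> ->; rewrite !col_mxEd.
  by rewrite (ord1 k) => /eqP; rewrite eq_sym (negPf (neq_lift _ _)).
- apply/matrixP => i j; rewrite ![row' _ _ _ _]mxE.
  case: (split_ordP (lift (lshift n (ord0 : 'I_1)) i)) => k; last by move=> ->; rewrite !col_mxEd.
  by rewrite (ord1 k) => /eqP; rewrite eq_sym (negPf (neq_lift _ _)).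
Qed.

Lemma char_poly_add_scale_rank1 (F : comNzRingType) (n : nat) (A : 'M[F]_n)
    (u v : 'cV[F]_n) (t : F) :
  char_poly (A + t *: (u *m v^T)) =
    t *: char_poly (A + u *m v^T) + (1 - t) *: char_poly A.
Proof.
have E s : char_poly_mx (A + s *: (u *m v^T)) = char_poly_mx A
    + s%:P *: (map_mx polyC (- u) *m (map_mx polyC v)^T).
  rewrite /char_poly_mx map_mxD map_mxZ map_mxM map_mxN map_trmx mulNmx scalerN.
  by rewrite opprD addrA.
have E1 : char_poly_mx (A + u *m v^T) = char_poly_mx A
    + map_mx polyC (- u) *m (map_mx polyC v)^T.
  by rewrite -[X in A + X]scale1r E polyC1 scale1r.
rewrite /char_poly E E1 det_add_scale_rank1.
by rewrite -!mul_polyC polyCB polyC1.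
Qed.

(** * The bialternate product and antisymmetric matrices *)

Section Bialternate.
Variables (F : fieldType) (n : nat).
Implicit Types (A B V : 'M[F]_n).

(** The entries above the diagonal serve as coordinates on antisymmetric matrices. *)
Definition wedge_row V : 'rV[F]_#|ord_pairs n| :=
  \row_r V (enum_val r).1 (enum_val r).2.

Lemma sum_ord_pairs (f : 'I_n -> 'I_n -> F) :
  (forall i, f i i = 0) ->
  \sum_(r < #|ord_pairs n|)
    (f (enum_val r).1 (enum_val r).2 + f (enum_val r).2 (enum_val r).1) =
  \sum_i \sum_j f i j.
Proof.
move=> f0; rewrite -(big_enum_val (fun p => f p.1 p.2 + f p.2 p.1)) /=.
transitivity (\sum_(p : 'I_n * 'I_n | (p.1 < p.2)%N) (f p.1 p.2 + f p.2 p.1)).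
  by apply: eq_bigl => p; rewrite inE.
rewrite big_split /= -(pair_big_dep xpredT (fun i j : 'I_n => (i < j)%N) f) /=.
rewrite -(pair_big_dep xpredT (fun i j : 'I_n => (i < j)%N) (fun i j => f j i)) /=.
rewrite [X in _ + X](exchange_big_dep xpredT) //= -big_split /=.
apply: eq_bigr => i _; rewrite [RHS](bigID (fun j : 'I_n => (i < j)%N)) /=; congr (_ + _).
rewrite [RHS](bigD1 i) ?ltnn //= f0 add0r; apply: eq_bigl => j.
by rewrite -leqNgt ltn_neqAle andbC.
Qed.

(** Entry (k, l) of A^T V A is the sum of V_ij a_ik a_jl; pairing (i, j) with (j, i) and using V_ji
    = - V_ij turns it into a sum of 2 x 2 minors of A. *)
Lemma wedge_row_bialternate A V : V^T = - V -> (forall i, V i i = 0) ->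
  (2%:R : F) != 0 ->
  wedge_row V *m bialternate A A = wedge_row (A^T *m V *m A).
Proof.
move=> VT V0 two; apply/rowP => s; rewrite !mxE.
case E: (enum_val s) => [k l] /=.
transitivity (\sum_i \sum_j V i j * A i k * A j l); last first.
  rewrite exchange_big /=; apply: eq_bigr => j _; rewrite mxE mulr_suml.
  by apply: eq_bigr => i _; rewrite mxE; ring.
rewrite -sum_ord_pairs; last by move=> i; rewrite V0 !mul0r.
apply: eq_bigr => r _; rewrite !mxE E; case: (enum_val r) => i j /=.
have -> : V j i = - V i j by have := congr1 (fun M : 'M_n => M i j) VT; rewrite !mxE.
by rewrite /det2; field.
Qed.

Lemma wedge_row_eq0 V : V^T = - V -> (forall i, V i i = 0) -> wedge_row V = 0 -> V = 0.
Proof.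
move=> VT V0 wV0.
have U (i j : 'I_n) : (i < j)%N -> V i j = 0.
  move=> ij; have ijP : (i, j) \in ord_pairs n by rewrite inE.
  have := congr1 (fun w : 'rV_ _ => w 0 (enum_rank_in ijP (i, j))) wV0.
  by rewrite !mxE enum_rankK_in.
apply/matrixP => i j; rewrite mxE; case: (ltngtP i j) => [/U //|ji|/val_inj ->] //.
have := congr1 (fun M : 'M_n => M i j) VT; rewrite !mxE (U _ _ ji).
by move/esym/eqP; rewrite oppr_eq0 => /eqP.
Qed.

Lemma wedge_row_surj (w : 'rV[F]_#|ord_pairs n|) :
  exists V, [/\ V^T = - V, forall i, V i i = 0 & wedge_row V = w].
Proof.
(* [g] places [w] above the diagonal and 0 elsewhere; V is [g] minus its transpose. *)
pose g (i j : 'I_n) := \sum_r (if enum_val r == (i, j) then w 0 r else 0).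
exists (\matrix_(i, j) (g i j - g j i)); split.
- by apply/matrixP => i j; rewrite !mxE opprB.
- by move=> i; rewrite mxE subrr.
apply/rowP => r; rewrite !mxE /g.
rewrite (bigD1 r) //= -surjective_pairing eqxx big1 => [|q /negPf qr]; last first.
  by rewrite (inj_eq enum_val_inj) qr.
rewrite big1 ?addr0 ?subr0 // => q _; case: eqP => // E.
have := enum_valP q; have := enum_valP r; rewrite E !inE /= => lt1.
by rewrite ltnNge (ltnW lt1).
Qed.

End Bialternate.

(** The coefficient of t^2 is the bialternate square of A1 - A2 = b (a - c)^T up to sign, and its
    entries are 2 x 2 minors of a rank-one matrix, hence 0. *)
Lemma bialternate_pencil (F : fieldType) (n : nat) (A0 : 'M[F]_n)
    (a b c : 'cV[F]_n) (t : F) :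
  let A1 := A0 + b *m a^T in
  let A2 := A0 + b *m c^T in
  let A := t *: A1 + (1 - t) *: A2 in
  (2%:R : F) != 0 ->
  1%:M - bialternate A2 A2
    + t *: ((- 2%:R) *: (bialternate A1 A2 - bialternate A2 A2))
  = 1%:M - bialternate A A.
Proof.
move=> A1 A2 A two; apply/matrixP => r s; rewrite !mxE.
case: (enum_val r) => i j; case: (enum_val s) => k l.
by rewrite !mxE !big_ord1 !mxE /det2; field.
Qed.

(** * Eigenvalues as zeros of determinants, and the Stein equation *)

Lemma eigenvalueE_det (F : fieldType) (n : nat) (A : 'M[F]_n) (x : F) :
  eigenvalue A x = (\det (A - x%:M) == 0).
Proof.
apply/eigenvalueP/det0P => -[v].
  by move=> vA v0; exists v; rewrite // mulmxBr vA mul_mx_scalar subrr.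
by move=> v0 /eqP; rewrite mulmxBr mul_mx_scalar subr_eq0 => /eqP vA; exists v.
Qed.

Lemma det_scale_eq0 (F : fieldType) (n : nat) (A : 'M[F]_n) (x : F) :
  x != 0 -> (\det (x *: A) == 0) = (\det A == 0).
Proof. by move=> x0; rewrite detZ mulf_eq0 expf_eq0 (negPf x0) andbF. Qed.

Lemma eigenvalue_mul_invmx (F : fieldType) (n : nat) (M N : 'M[F]_n) (x : F) :
  N \in unitmx -> eigenvalue (M *m invmx N) x = (\det (M - x *: N) == 0).
Proof.
move=> uN; rewrite eigenvalueE_det.
have -> : M - x *: N = (M *m invmx N - x%:M) *m N.
  by rewrite mulmxBl mulmxKV // mul_scalar_mx.
rewrite det_mulmx mulf_eq0 orbC.
by move: uN; rewrite unitmxE unitfE => /negPf ->.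
Qed.

Lemma eigenvalue_opp_invmx_mul (F : fieldType) (n : nat) (M N : 'M[F]_n) (x : F) :
  M \in unitmx -> x != 0 ->
  eigenvalue (- (invmx M *m N)) x = (\det (M + x^-1 *: N) == 0).
Proof.
move=> uM x0; rewrite eigenvalueE_det.
have -> : M + x^-1 *: N = (- x^-1) *: (M *m (- (invmx M *m N) - x%:M)).
  rewrite mulmxBr mulmxN mulKVmx // mul_mx_scalar scalerBr scalerN scaleNr opprK.
  by rewrite scaleNr opprK scalerA mulVf // scale1r addrC.
rewrite det_scale_eq0 ?oppr_eq0 ?invr_eq0 // det_mulmx mulf_eq0.
by move: uM; rewrite unitmxE unitfE => /negPf ->.
Qed.

(* By Cayley-Hamilton, [V] is annihilated by the product of the [A - z], each of
   which can be cancelled because [A^T *m V *m (A - z) = (1 - z *: A^T) *m V]. *)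
Lemma stein_eq0 (C : numClosedFieldType) (n : nat) (A V : 'M[C]_n) :
  (forall z, eigenvalue A z -> `|z| < 1) -> A^T *m V *m A = V -> V = 0.
Proof.
case: n => [|n] in A V *; first by rewrite (flatmx0 V).
move=> stA AVA.
have [s As] := closed_field_poly_normal (char_poly A).
rewrite (monicP (char_poly_monic A)) scale1r in As.
have ev z : z \in s -> `|z| < 1.
  move=> zs; apply: stA; rewrite eigenvalue_root_char As.
  by rewrite root_prod_XsubC.
have := Cayley_Hamilton A; rewrite As.
have U z : z \in s -> 1%:M - z *: A^T \in unitmx.
  move=> zs; rewrite -unitmx_tr !linearB /= linearZ /= trmx1 trmxK.
  rewrite unitmxE unitfE; have [->|z0] := eqVneq z 0.
    by rewrite scale0r subr0 det1 oner_eq0.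
  (* If 1 - z A were singular, z^-1 would be an eigenvalue of A, so both z and z^-1 would have
     modulus less than 1. *)
  have -> : 1%:M - z *: A = (- z) *: (A - z^-1%:M).
    by rewrite scalerBr !scaleNr opprK scale_scalar_mx mulfV // addrC.
  rewrite det_scale_eq0 ?oppr_eq0 // -eigenvalueE_det.
  apply/negP => /stA; rewrite normfV invf_lt1 ?normr_gt0 //.
  by move=> /lt_trans /(_ (ev _ zs)); rewrite ltxx.
move=> Q0; have {Q0} : V *m horner_mx A (\prod_(z <- s) ('X - z%:P)) = 0.
  by rewrite Q0 mulmx0.
elim: s U {As ev} => [|z s IH] U; first by rewrite big_nil rmorph1 mulmx1.
rewrite big_cons rmorphM rmorphB /= horner_mx_X horner_mx_C => Q0.
apply: IH => [y ys|]; first by apply: U; rewrite inE ys orbT.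
set Q := horner_mx _ _ in Q0 *.
have E : (1%:M - z *: A^T) *m (V *m Q) = 0.
  have -> : (1%:M - z *: A^T) *m (V *m Q) = A^T *m (V *m ((A - z%:M) * Q)).
    rewrite -mulmxE !mulmxBl mul1mx mul_scalar_mx !mulmxBr -!scalemxAl -!scalemxAr.
    by rewrite !mulmxA AVA.
  by rewrite Q0 mulmx0.
by have := mulKmx (U z (mem_head _ _)) (V *m Q); rewrite E mulmx0.
Qed.

(** * The bialternate square and eigenvalues on the unit circle *)

(** A kernel row is the coordinate row of an antisymmetric V with A^T V A = V; after passing to
    complex entries, [stein_eq0] gives V = 0. *)
Lemma schur_stable_bialternate (R : realType) (n : nat) (A : 'M[R]_n) :
  schur_stable A -> 1%:M - bialternate A A \in unitmx.
Proof.
move=> stA; rewrite unitmxE unitfE; apply/det0P => -[w w0].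
have [V [VT V0 wV]] := wedge_row_surj w.
move/eqP; rewrite -wV mulmxBr mulmx1 wedge_row_bialternate // ?pnatr_eq0 //.
rewrite subr_eq0 => /eqP E.
have AVT : (A^T *m V *m A)^T = - (A^T *m V *m A).
  by rewrite !trmx_mul trmxK VT mulNmx mulmxN mulmxA.
have AV0 i : (A^T *m V *m A) i i = 0.
  have := congr1 (fun M : 'M_n => M i i) AVT; rewrite [LHS]mxE [RHS]mxE => /eqP.
  by rewrite -addr_eq0 -mulr2n mulrn_eq0 /= => /eqP.
have {E}E : V - A^T *m V *m A = 0.
  apply: wedge_row_eq0; first by rewrite linearB /= AVT VT opprD.
    by move=> i; rewrite [LHS]mxE [X in _ + X]mxE AV0 V0 subrr.
  by move: E; rewrite /wedge_row => /rowP E; apply/rowP => r; move: (E r);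
     rewrite !mxE => ->; rewrite subrr.
have VE : V = 0.
  apply: (map_mx_inj (f := real_complex R)); rewrite map_mx0.
  apply: (stein_eq0 stA); rewrite map_trmx -!map_mxM.
  by rewrite {2}(subr0_eq E).
by case/eqP: w0; rewrite -wV VE; apply/rowP => r; rewrite !mxE.
Qed.

Lemma unit_circle_eigenvalue (R : realType) (n : nat) (A : 'M[R]_n) (z : R[i]) :
  eigenvalue (map_mx (real_complex R) A) z -> `|z| = 1 ->
  [\/ eigenvalue A 1, eigenvalue A (-1) | \det (1%:M - bialternate A A) == 0].
Proof.
move=> /eigenvalueP [v vA v0] z1.
case: z => s t in vA z1.
have st : s ^+ 2 + t ^+ 2 = 1.
  by apply: (@complexI R); have := add_Re2_Im2 (s +i* t)%C; rewrite z1 expr1n /= => ->.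
have [x [y vE]] : exists x y : 'rV[R]_n,
    v = map_mx (real_complex R) x + 'i%C *: map_mx (real_complex R) y.
  exists (map_mx (@complex.Re R) v), (map_mx (@complex.Im R) v).
  by apply/rowP => j; rewrite !mxE -complexE.
(* Real and imaginary parts of v A = (s + i t) v. *)
have [xA yA] : x *m A = s *: x - t *: y /\ y *m A = t *: x + s *: y.
  have E : map_mx (real_complex R) (x *m A) + 'i%C *: map_mx (real_complex R) (y *m A)
     = (s +i* t)%C *: v by rewrite -vA {1}vE mulmxDl !map_mxM scalemxAl.
  have comb (X Y : 'rV[R]_n) j :
      (map_mx (real_complex R) X + 'i%C *: map_mx (real_complex R) Y) 0 j
      = (X 0 j +i* Y 0 j)%C by rewrite !mxE [RHS]complexE.
  by split; apply/rowP => j; move/rowP/(_ j): E; rewrite comb vE [RHS]mxE comb;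
    simpc => -[E1 E2]; rewrite ?E1 ?E2 !mxE // addrC.
have xy0 : (x != 0) || (y != 0).
  rewrite -negb_and; apply: contra v0 => /andP[/eqP x0 /eqP y0].
  by rewrite vE x0 y0 !map_mx0 scaler0 addr0.
have [t0|t0] := eqVneq t 0.
  have s1 : eigenvalue A s.
    by case/orP: xy0 => nz; apply/eigenvalueP; [exists x|exists y] => //;
      rewrite ?xA ?yA t0 scale0r ?subr0 ?add0r.
  move/eqP: st; rewrite t0 expr0n addr0 sqrf_eq1 => /orP[]/eqP sE.
    by constructor 1; rewrite -sE.
  by constructor 2; rewrite -sE.
constructor 3.
pose V := x^T *m y - y^T *m x.
have VE i j : V i j = x 0 i * y 0 j - y 0 i * x 0 j by rewrite !mxE !big_ord1 !mxE.
have VT : V^T = - V by rewrite /V linearB /= !trmx_mul !trmxK opprB.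
have V0 i : V i i = 0 by rewrite VE mulrC subrr.
(* A acts on the pair (x, y) by a matrix of determinant s^2 + t^2 = 1, so it preserves the wedge of
   x and y. *)
have AVA : A^T *m V *m A = V.
  have -> : A^T *m V *m A = (x *m A)^T *m (y *m A) - (y *m A)^T *m (x *m A).
    by rewrite !trmx_mul /V mulmxBr mulmxBl !mulmxA.
  apply/matrixP => i j; rewrite xA yA VE !mxE !big_ord1 !mxE.
  by rewrite -[RHS]mul1r -st; ring.
apply/det0P; exists (wedge_row V); last first.
  by rewrite mulmxBr mulmx1 wedge_row_bialternate ?pnatr_eq0 // AVA subrr.
apply/eqP => /(wedge_row_eq0 VT V0) Vz.
have xyz i j : x 0 i * y 0 j = y 0 i * x 0 j.
  by apply/eqP; rewrite -subr_eq0 -VE Vz mxE.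
(* Here [w] is the imaginary part of [conj (v_j) *: v]: it vanishes because
   [V = 0], and then so does the imaginary part [t *: (...)] of the eigenvalue
   equation. *)
suff xyj j : x 0 j ^+ 2 + y 0 j ^+ 2 = 0.
  have : (x == 0) && (y == 0).
    apply/andP; split; apply/eqP/rowP => j; have /eqP := xyj j;
      by rewrite paddr_eq0 ?sqr_ge0 // !sqrf_eq0 mxE => /andP[/eqP ? /eqP ?].
  by rewrite -[_ && _]negbK negb_and xy0.
pose w := x 0 j *: y - y 0 j *: x.
have w0 : w = 0 by apply/rowP => i; rewrite !mxE xyz; ring.
have : w *m A = s *: w + t *: (x 0 j *: x + y 0 j *: y).
  by rewrite mulmxBl -!scalemxAl xA yA; apply/rowP => i; rewrite !mxE; ring.
rewrite w0 mul0mx scaler0 add0r => /rowP /(_ j); rewrite !mxE => /esym/eqP.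
by rewrite mulf_eq0 (negPf t0) /= !expr2 => /eqP.
Qed.

(** * Perturbation of monic polynomials and the open unit disc *)

Section RootsInDisc.
Variable C : numClosedFieldType.
Implicit Types (p q : {poly C}) (z h : C).

Definition roots_in_disc p := forall z, root p z -> `|z| < 1.

(** For |z| >= 1, |z - x| >= |z| - |x| >= (1 - |x|) |z|; K is the product of the 1 - |x|. The growth
    in |z| matches that of [norm_horner_le]. *)
Lemma prod_norm_ge (s : seq C) : (forall x, x \in s -> `|x| < 1) ->
  exists2 K : C, 0 < K & forall z, 1 <= `|z| ->
    K * `|z| ^+ size s <= \prod_(x <- s) `|z - x|.
Proof.
elim: s => [|x s IH] sx.
  by exists 1 => // z _; rewrite big_nil mul1r expr0.
have [|K K0 HK] := IH; first by move=> y ys; apply: sx; rewrite inE ys orbT.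
have x1 : 0 < 1 - `|x| by rewrite subr_gt0 sx ?mem_head.
exists ((1 - `|x|) * K); first exact: mulr_gt0.
move=> z z1; rewrite big_cons exprS mulrACA ler_pM ?(mulr_ge0, exprn_ge0, ltW x1, ltW K0) //.
  apply: le_trans (lerB_dist z x); rewrite mulrBl mul1r lerD2l lerN2.
  by rewrite ler_peMr.
exact: HK.
Qed.

(** Unlike the previous bound, this one depends only on the number of roots, so it is uniform over
    perturbed polynomials. *)
Lemma prod_norm_ge_exp (s : seq C) z : (forall x, x \in s -> `|x| < 1) ->
  1 <= `|z| -> (`|z| - 1) ^+ size s <= \prod_(x <- s) `|z - x|.
Proof.
move=> sx z1; elim: s sx => [|x s IH] sx; first by rewrite big_nil expr0.
rewrite big_cons exprS ler_pM ?exprn_ge0 ?subr_ge0 //.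
  apply: le_trans (lerB_dist z x); rewrite lerD2l lerN2.
  by rewrite ltW ?sx ?mem_head.
by apply: IH => y ys; apply: sx; rewrite inE ys orbT.
Qed.

Lemma monic_roots_in_disc p : p \is monic -> roots_in_disc p ->
  exists s : seq C, [/\ size p = (size s).+1, forall x, x \in s -> `|x| < 1
    & forall z, `|p.[z]| = \prod_(x <- s) `|z - x|].
Proof.
move=> /monicP p1 pd; have [s ps] := closed_field_poly_normal p.
rewrite p1 scale1r in ps; exists s; split.
- by rewrite ps size_prod_XsubC.
- by move=> x xs; apply: pd; rewrite ps root_prod_XsubC.
move=> z; rewrite ps horner_prod normr_prod.
by apply: eq_bigr => x _; rewrite hornerXsubC.
Qed.

Lemma norm_horner_le q (m : nat) z : (size q <= m.+1)%N -> 1 <= `|z| ->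
  `|q.[z]| <= (\sum_(i < size q) `|q`_i|) * `|z| ^+ m.
Proof.
move=> qm z1; rewrite horner_coef (le_trans (ler_norm_sum _ _ _)) // mulr_suml.
apply: ler_sum => i _; rewrite normrM normrX ler_wpM2l //.
by rewrite ler_weXn2l // -ltnS (leq_trans (ltn_ord i)).
Qed.

(** For |z| >= 1, |p(z)| >= K |z|^m exceeds |h q(z)| when h is small, so the sum has no root
    there. *)
Lemma roots_in_disc_open p q : p \is monic -> roots_in_disc p ->
  (size q <= size p)%N ->
  exists2 e : C, 0 < e & forall h, `|h| < e -> roots_in_disc (p + h *: q).
Proof.
move=> pm pd; have [s [-> sd pE]] := monic_roots_in_disc pm pd => qs.
have [K K0 HK] := prod_norm_ge sd.
set S := \sum_(i < size q) `|q`_i|.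
have S0 : 0 <= S by apply: sumr_ge0.
have S1 : 0 < S + 1 by rewrite ltr_wpDl.
(* S may be 0, hence the denominator S + 1. *)
exists (K / (S + 1)); first exact: divr_gt0.
move=> h; rewrite ltr_pdivlMr // => hK z /rootP.
rewrite hornerD hornerZ => /eqP; rewrite addr_eq0 => /eqP pz.
rewrite real_ltNge ?normr_real ?real1 //; apply/negP => z1.
have := HK z z1; rewrite -pE pz normrN normrM.
move=> /le_trans /(_ (ler_wpM2l (normr_ge0 h) (norm_horner_le qs z1))).
rewrite mulrA ler_pM2r ?exprn_gt0 ?(lt_le_trans ltr01) // -/S => KS.
have := le_lt_trans KS (le_lt_trans _ hK); rewrite mulrDr mulr1 lerDl normr_ge0.
by rewrite ltxx => /(_ isT).
Qed.

(** If the perturbed polynomial had all its roots in the disc, its modulus at z would be at least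
    (|z| - 1)^m, m its degree; but its value there is h q(z), which is small. *)
Lemma root_out_disc_open p q z : 1 < `|z| -> root p z ->
  exists2 e : C, 0 < e & forall h, `|h| < e ->
    p + h *: q \is monic -> size (p + h *: q) = size p ->
    ~ roots_in_disc (p + h *: q).
Proof.
move=> z1 /rootP pz.
have S1 : 0 < `|q.[z]| + 1 by rewrite ltr_wpDl.
have K0 : 0 < (`|z| - 1) ^+ (size p).-1 by rewrite exprn_gt0 // subr_gt0.
exists ((`|z| - 1) ^+ (size p).-1 / (`|q.[z]| + 1)); first exact: divr_gt0.
move=> h; rewrite ltr_pdivlMr // => hK pm ps pd.
have [s [sz sd pE]] := monic_roots_in_disc pm pd.
have := prod_norm_ge_exp sd (ltW z1); rewrite -pE hornerD hornerZ pz add0r.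
rewrite (_ : size s = (size p).-1); last by rewrite -ps sz.
rewrite normrM => KS; have := le_lt_trans KS (le_lt_trans _ hK).
by rewrite mulrDr mulr1 lerDl normr_ge0 ltxx => /(_ isT).
Qed.

End RootsInDisc.

(** * Connectedness of [0, 1] and stability along a rank-one segment *)

Lemma clopen_unit_interval (R : realType) (P : R -> Prop) :
  P 0 ->
  (forall t, 0 <= t <= 1 -> P t -> exists2 e, 0 < e &
     forall u, 0 <= u <= 1 -> `|u - t| < e -> P u) ->
  (forall t, 0 <= t <= 1 -> ~ P t -> exists2 e, 0 < e &
     forall u, 0 <= u <= 1 -> `|u - t| < e -> ~ P u) ->
  forall t, 0 <= t <= 1 -> P t.
Proof.
move=> P0 Po Pc.
(* E collects the t up to which P holds throughout; its supremum m satisfies P by closedness, and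
   openness forces m = 1. *)
pose E : classical_sets.set R :=
  fun t => 0 <= t <= 1 /\ forall s, 0 <= s <= t -> P s.
have E0 : E 0.
  split; first by rewrite lexx ler01.
  by move=> s; rewrite -eq_le => /eqP <-.
have supE : classical_sets.has_sup E.
  by split; [exists 0|exists 1 => t [/andP[]]].
set m := sup E.
have Em t : E t -> t <= m by move=> Et; apply: ub_le_sup => //; case: supE.
have m01 : 0 <= m <= 1.
  by rewrite Em //=; apply: ge_sup; [exists 0|move=> t [/andP[]]].
have below s : 0 <= s -> s < m -> P s.
  move=> s0 sm; have [|e [_ eP]] := sup_adherent (E := E) (eps := m - s) _ supE.
    by rewrite subr_gt0.
  by rewrite -/m subKr => /ltW se; apply: eP; rewrite s0.
have Pm : P m.
  apply: boolp.contrapT => nPm; have [e e0 He] := Pc m m01 nPm.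
  have [x Ex xm] := sup_adherent e0 supE.
  case: (Ex) => x01 Px; apply: (He x x01); last first.
    by apply: Px; case/andP: x01 => ->; rewrite lexx.
  by rewrite -/m in xm; have := Em _ Ex; rewrite ltr_norml; lra.
have [e e0 He] := Po m m01 Pm.
(* This element of E is at most m, which is possible only if 1 <= m. *)
have Eu : E (Num.min 1 (m + e / 2)).
  have min0 : 0 <= Num.min 1 (m + e / 2) by rewrite le_min; lra.
  split; first by rewrite min0 ge_min lexx.
  move=> s; rewrite le_min => /and3P[s0 s1 sme].
  have [|ms] := ltP s m; first exact: below.
  by apply: He; rewrite ?s0 ?s1 // ger0_norm; lra.
move=> t /andP[t0 t1]; case: Eu (Em _ Eu) => _ Pu; rewrite ge_min => /orP[m1|]; last by lra.
apply: Pu; rewrite t0 le_min t1; lra.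
Qed.

Lemma pos_complex (R : realType) (e : R[i]) :
  0 < e -> exists2 r : R, 0 < r & e = real_complex R r.
Proof. by case: e => a b; rewrite ltcE /= => /andP[/eqP-> a0]; exists a. Qed.

Lemma norm_real_complex (R : realType) (r : R) :
  `|real_complex R r| = real_complex R `|r|.
Proof. by rewrite normc_def /= expr0n addr0 sqrtr_sqr. Qed.

Lemma schur_stable_roots (R : realType) (n : nat) (A : 'M[R]_n) :
  schur_stable A <-> roots_in_disc (char_poly (map_mx (real_complex R) A)).
Proof.
by split=> stA z; [rewrite -eigenvalue_root_char|rewrite eigenvalue_root_char]; apply: stA.
Qed.

Lemma convex_combE (S : pzRingType) (L : lmodType S) (p q : L) (t : S) :
  t *: p + (1 - t) *: q = q + t *: (p - q).
Proof. by rewrite scalerBl scale1r scalerBr addrCA. Qed.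

Lemma schur_stable_rank1_segment (R : realType) (n : nat) (A : 'M[R]_n) (u v : 'cV[R]_n) :
  let B t := A + t *: (u *m v^T) in
  schur_stable A ->
  (forall t z, 0 <= t <= 1 -> eigenvalue (map_mx (real_complex R) (B t)) z -> `|z| != 1) ->
  forall t, 0 <= t <= 1 -> schur_stable (B t).
Proof.
move=> B stA nunit.
pose p t := char_poly (map_mx (real_complex R) (B t)).
pose q := p 1 - p 0.
(* The characteristic polynomial is affine in the parameter, so moving from t to s adds a multiple
   of the fixed polynomial [q]. *)
have pE t s : p s = p t + real_complex R (s - t) *: q.
  have E r : p r = real_complex R r *: p 1 + (1 - real_complex R r) *: p 0.
    rewrite /p /B scale1r scale0r addr0 !map_mxD map_mxZ !map_mxM -!map_trmx.
    exact: char_poly_add_scale_rank1.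
  by rewrite (E s) (E t) !convex_combE -addrA -scalerDl addrC rmorphB subrKC addrC.
have psz t : size (p t) = n.+1 by rewrite size_char_poly.
have pm t : p t \is monic by apply: char_poly_monic.
have qsz t : (size q <= size (p t))%N.
  by rewrite (leq_trans (size_polyD _ _)) // size_polyN !psz maxnn.
have pst t : schur_stable (B t) <-> roots_in_disc (p t) by apply: schur_stable_roots.
have pev t z : eigenvalue (map_mx (real_complex R) (B t)) z = root (p t) z.
  exact: eigenvalue_root_char.
clearbody p q.
apply: (clopen_unit_interval (P := fun t => schur_stable (B t))).
- by rewrite /B scale0r addr0.
- move=> t t01 /pst pt.
  have [e /pos_complex [r r0 ->] He] := roots_in_disc_open (pm t) pt (qsz t).
  exists r; first exact: r0.
  move=> s _ sr; apply/pst; rewrite (pE t s).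
  by apply: He; rewrite norm_real_complex ltcR.
move=> t t01 nst.
(* An unstable matrix without eigenvalues of modulus 1 has one of modulus greater than 1. *)
have [z [pz z1]] : exists z, root (p t) z /\ 1 < `|z|.
  apply: boolp.contrapT => nz; apply: nst => z ev.
  rewrite real_ltNge ?normr_real ?real1 // le_eqVlt negb_or eq_sym (nunit t) //=.
  by apply/negP => z1; apply: nz; exists z; rewrite -pev.
have [e /pos_complex [r r0 ->] He] := root_out_disc_open q z1 pz.
exists r; first exact: r0.
move=> s _ sr /pst; have := He (real_complex R (s - t)).
by rewrite -pE !psz norm_real_complex ltcR; apply.
Qed.

(** * Conditions (i) and (ii) in terms of the segment parameter *)

Lemma det_opp_eq0 (F : fieldType) (n : nat) (A : 'M[F]_n) : (\det (- A) == 0) = (\det A == 0).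
Proof. by rewrite -scaleN1r det_scale_eq0 // oppr_eq0 oner_eq0. Qed.

Lemma schur_stable_real_eigenvalue (R : realType) (n : nat) (A : 'M[R]_n) (x : R) :
  schur_stable A -> `|x| = 1 -> ~~ eigenvalue A x.
Proof.
move=> stA x1; apply/negP; rewrite -(eigenvalue_map (real_complex R)) => /stA.
by rewrite norm_real_complex x1 ltxx.
Qed.

Lemma eigenvalue1_sub (F : fieldType) (n : nat) (A : 'M[F]_n) :
  eigenvalue A 1 = (\det (1%:M - A) == 0).
Proof. by rewrite eigenvalueE_det -det_opp_eq0 opprB. Qed.

Lemma eigenvalueN1_add (F : fieldType) (n : nat) (A : 'M[F]_n) :
  eigenvalue A (-1) = (\det (1%:M + A) == 0).
Proof. by rewrite eigenvalueE_det raddfN opprK addrC. Qed.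

(* The map [t |-> - (1 - t) / t] is a bijection from ]0, 1[ to ]-oo, 0[. *)
Lemma neg_eigenvalue_segment (F : realFieldType) (n : nat) (M N : 'M[F]_n) :
  N \in unitmx ->
  (forall x, x < 0 -> ~~ eigenvalue (M *m invmx N) x) <->
  (forall t, 0 < t < 1 -> \det (t *: M + (1 - t) *: N) != 0).
Proof.
move=> uN; split=> H.
  move=> t /andP[t0 t1]; have tn0 : t != 0 by rewrite gt_eqF.
  have x0 : - (1 - t) / t < 0 by rewrite pmulr_llt0 ?invr_gt0 // oppr_lt0 subr_gt0.
  have := H _ x0; rewrite eigenvalue_mul_invmx // -(det_scale_eq0 _ tn0) scalerBr.
  by rewrite scalerA mulrC divfK // scaleNr opprK.
move=> x x0; have d0 : 0 < 1 - x by lra.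
have dn0 : 1 - x != 0 by rewrite gt_eqF.
have t01 : 0 < (1 - x)^-1 < 1 by rewrite invr_gt0 d0 invf_lt1 //; lra.
have := H _ t01; rewrite eigenvalue_mul_invmx // -(det_scale_eq0 _ dn0) scalerDr !scalerA.
rewrite mulfV // scale1r (_ : (1 - x) * _ = - x) ?scaleNr //.
by field.
Qed.

(** The substitution x = 1 / t exchanges [1, +oo[ and ]0, 1]. *)
Lemma ge1_eigenvalue_segment (F : realFieldType) (n : nat) (M N : 'M[F]_n) :
  M \in unitmx ->
  (forall x, 1 <= x -> ~~ eigenvalue (- (invmx M *m N)) x) <->
  (forall t, 0 < t <= 1 -> \det (M + t *: N) != 0).
Proof.
move=> uM; split=> H.
  move=> t /andP[t0 t1]; have tn0 : t != 0 by rewrite gt_eqF.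
  have x1 : 1 <= t^-1 by rewrite invf_ge1.
  by have := H _ x1; rewrite eigenvalue_opp_invmx_mul ?invr_eq0 // invrK.
move=> x x1; have x0 : 0 < x by lra.
have xn0 : x != 0 by rewrite gt_eqF.
rewrite eigenvalue_opp_invmx_mul //; apply: H.
by rewrite invr_gt0 x0 invf_le1.
Qed.

(** * The stability criterion for the segment *)

Theorem lemma3p3 (R : realType) (n : nat) (A0 : 'M[R]_n) (a b c : 'cV[R]_n) :
  let A1 := A0 + b *m a^T in
  let A2 := A0 + b *m c^T in
  let F0 := 1%:M - bialternate A2 A2 in
  let F1 := (- 2%:R) *: (bialternate A1 A2 - bialternate A2 A2) in
  schur_stable A1 ->
  schur_stable A2 ->
  \rank (A1 - A2) = 1%N ->
  (forall alpha : R, 0 <= alpha <= 1 ->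
     schur_stable (alpha *: A1 + (1 - alpha) *: A2))
  <->
  [/\ forall x : R, x < 0 ->
        ~~ eigenvalue ((1%:M - A1) *m invmx (1%:M - A2)) x,
      forall x : R, x < 0 ->
        ~~ eigenvalue ((1%:M + A1) *m invmx (1%:M + A2)) x
    & forall x : R, 1 <= x ->
        ~~ eigenvalue (- (invmx F0 *m F1)) x].
Proof.
move=> A1 A2 F0 F1 st1 st2 _.
pose A t := t *: A1 + (1 - t) *: A2.
have u1 : 1%:M - A2 \in unitmx.
  rewrite unitmxE unitfE -eigenvalue1_sub.
  by apply: schur_stable_real_eigenvalue; rewrite ?normr1.
have u2 : 1%:M + A2 \in unitmx.
  rewrite unitmxE unitfE -eigenvalueN1_add.
  by apply: schur_stable_real_eigenvalue; rewrite ?normrN1.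
have uF0 : F0 \in unitmx := schur_stable_bialternate st2.
have EB t : t *: (1%:M - A1) + (1 - t) *: (1%:M - A2) = 1%:M - A t.
  by rewrite !scalerBr addrACA -opprD -scalerDl subrKC scale1r.
have ED t : t *: (1%:M + A1) + (1 - t) *: (1%:M + A2) = 1%:M + A t.
  by rewrite (scalerDr t 1%:M) (scalerDr _ 1%:M) addrACA -scalerDl subrKC scale1r.
have EF t : F0 + t *: F1 = 1%:M - bialternate (A t) (A t).
  by apply: bialternate_pencil; rewrite pnatr_eq0.
have -> : (forall alpha : R, 0 <= alpha <= 1 -> schur_stable (A alpha)) <->
  [/\ forall t, 0 < t < 1 -> \det (t *: (1%:M - A1) + (1 - t) *: (1%:M - A2)) != 0,
      forall t, 0 < t < 1 -> \det (t *: (1%:M + A1) + (1 - t) *: (1%:M + A2)) != 0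
    & forall t, 0 < t <= 1 -> \det (F0 + t *: F1) != 0]; last first.
  by split=> -[H1 H2 H3]; split; exact/neg_eigenvalue_segment || exact/ge1_eigenvalue_segment.
split=> [stA|[H1 H2 H3]].
  split=> t t01.
  - rewrite EB -eigenvalue1_sub; apply: schur_stable_real_eigenvalue (normr1 _).
    by apply: stA; case/andP: t01 => /ltW -> /ltW ->.
  - rewrite ED -eigenvalueN1_add; apply: schur_stable_real_eigenvalue (normrN1 _).
    by apply: stA; case/andP: t01 => /ltW -> /ltW ->.
  rewrite EF -unitfE -unitmxE; apply: schur_stable_bialternate; apply: stA.
  by case/andP: t01 => /ltW -> ->.
have AE t : A t = A2 + t *: (b *m (a - c)^T).
  rewrite /A convex_combE; congr (_ + _ *: _).
  by rewrite [(a - c)^T]linearB mulmxBr /A1 /A2 opprD addrACA subrr add0r.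
move=> alpha alpha01; rewrite -/(A alpha) AE.
apply: schur_stable_rank1_segment => // t z t01; rewrite -AE => ev.
apply/eqP => z1.
(* The endpoints are stable by assumption; the determinant conditions at 1 and -1 cover only the
   open interval. *)
have [t0|tn0] := eqVneq t 0.
  by move: ev z1; rewrite t0 /A scale0r add0r subr0 scale1r => /st2 /lt_eqF /eqP.
have [t1|tn1] := eqVneq t 1.
  by move: ev z1; rewrite t1 /A scale1r subrr scale0r addr0 => /st1 /lt_eqF /eqP.
have tt : 0 < t < 1 by rewrite !lt_neqAle eq_sym tn0 tn1.
case: (unit_circle_eigenvalue ev z1).
- by rewrite eigenvalue1_sub -EB => E; have := H1 t tt; rewrite E.
- by rewrite eigenvalueN1_add -ED => E; have := H2 t tt; rewrite E.
by rewrite -EF => E; have := H3 t; rewrite E; case/andP: tt => -> /ltW -> /(_ isT).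
Qed.
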